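(* Let $r\ge 1$ and let $\mathcal{H}$ be an $r$-graph on $n$ vertices with $e$ edges. Then $$i_1(\mathcal{H})\le i_1(\mathcal{C}_r(n,e)).$$
   Context: $[n]=\{0,1,\dots,n-1\}$. An $r$-graph is an $r$-uniform hypergraph. A set $I$ of vertices is $1$-independent in $\mathcal{H}$ if $|I\cap E|<1$ for every edge $E$; $i_1(\mathcal{H})$ is the number of $1$-independent sets. The colex order on $\binom{[n]}{r}$ is defined by $A<_C B$ iff $\max(A\mathbin{\triangle}B)\in B$. The colex $r$-graph $\mathcal{C}_r(n,e)$ has vertex set $[n]$ and edge set the first $e$ sets of $\binom{[n]}{r}$ in colex order. *)

(* Defs.v *)
From mathcomp Require Import all_boot.

Set Implicit Arguments.
Unset Strict Implicit.
Unset Printing Implicit Defensive.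

(* A hypergraph on the vertex set T is given by its set of edges
   H : {set {set T}}; it is an r-graph when it is r-uniform. *)
Definition is_rgraph (T : finType) (r : nat) (H : {set {set T}}) : Prop :=
  forall E : {set T}, E \in H -> #|E| = r.

Definition one_independent (T : finType) (H : {set {set T}}) (I : {set T}) :
    bool :=
  [forall E in H, #|I :&: E| < 1].

Definition i1 (T : finType) (H : {set {set T}}) : nat :=
  #|[set I : {set T} | one_independent H I]|.

Definition symdiff (T : finType) (A B : {set T}) : {set T} :=
  (A :\: B) :|: (B :\: A).

(* The maximum of the symmetric difference is the witness m; for A = B there
   is no maximum and the relation is false. *)
Definition colex_lt (n : nat) (A B : {set 'I_n}) : bool :=
  [exists m : 'I_n,
    [&& m \in symdiff A B, [forall k in symdiff A B, k <= m] & m \in B]].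

Definition colex_le (n : nat) (A B : {set 'I_n}) : bool :=
  (A == B) || colex_lt A B.

Definition colex_list (r n : nat) : seq {set 'I_n} :=
  sort (@colex_le n) (enum [set A : {set 'I_n} | #|A| == r]).

(* For e > 'C(n, r) this is the complete r-graph on 'I_n. *)
Definition colex_graph (r n e : nat) : {set {set 'I_n}} :=
  [set:: take e (colex_list r n)].

(* Main.v *)
Require Import Defs.
From mathcomp Require Import all_boot.

(** A set is 1-independent iff it avoids the vertices covered by the edges, so
    [i1 H] is a power of two that only depends on the number [c] of covered
    vertices.  Since [e <= 'C(c, r)] and the [r]-subsets of the initial segment
    [[c]] come first in colex order, the first [e] sets in colex order only
    cover vertices of [[c]]. *)

Lemma i1E (T : finType) (H : {set {set T}}) : i1 H = 2 ^ #|~: cover H|.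
Proof.
rewrite -card_powerset; apply: eq_card => I; rewrite !inE subsets_disjoint setCK.
apply/'forall_implyP/bigcup_disjointP => indI E /indI;
  by rewrite ltnS leqn0 cards_eq0 setI_eq0.
Qed.

(** Every edge is one of the [r]-subsets of [cover H]. *)
Lemma card_rgraph_leq (T : finType) (r : nat) (H : {set {set T}}) :
  is_rgraph r H -> #|H| <= 'C(#|cover H|, r).
Proof.
move=> rH; rewrite -cards_draws subset_leq_card //.
by apply/subsetP => E EH; rewrite inE bigcup_sup //= (rH _ EH).
Qed.

Lemma card_initial_segment (n c : nat) :
  c <= n -> #|[set i : 'I_n | i < c]| = c.
Proof.
by move=> le_cn; rewrite -sum1dep_card (big_ord_narrow le_cn) sum1_card card_ord.
Qed.

Section ColexOrder.

Variable n : nat.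
Implicit Types A B C : {set 'I_n}.

(** Trades the maximum of the symmetric difference for agreement above [m], a condition that
    composes along chains of sets. *)
Lemma colex_ltP A B :
  reflect (exists m : 'I_n, [/\ m \notin A, m \in B &
             forall k : 'I_n, m < k -> (k \in A) = (k \in B)])
          (colex_lt A B).
Proof.
apply: (iffP existsP) => -[m].
  case/and3P=> + /forall_inP maxm mB; rewrite !inE mB /= andbT => mA.
  exists m; split=> // k; rewrite ltnNge; move: (maxm k); rewrite !inE.
  by case: (k \in A); case: (k \in B) => //= /(_ isT) ->.
case=> mA mB eqAB; exists m; rewrite !inE mA mB /= andbT.
apply/forall_inP => k; rewrite leqNgt !inE; apply: contraL => /eqAB ->.
by rewrite andbC orbb andbN.
Qed.

Lemma colex_le_total : total (@colex_le n).
Proof.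
move=> A B; rewrite /colex_le eq_sym; have [-> // | neqBA] := eqVneq B A.
have [m0 m0D] : exists m0, m0 \in symdiff A B.
  apply/set0Pn; apply: contra neqBA => /eqP/setP D0; apply/eqP/setP => k.
  by move: (D0 k); rewrite !inE; case: (k \in A); case: (k \in B).
(* Whichever of the two sets contains the largest point [m] of the symmetric difference is the
   colex-larger one. *)
case: (@arg_maxnP _ m0 (fun k => k \in symdiff A B) val m0D) => m mD maxm.
have eqAB (k : 'I_n) : m < k -> (k \in A) = (k \in B).
  rewrite ltnNge; move: (maxm k); rewrite /= !inE.
  by case: (k \in A); case: (k \in B) => //= /(_ isT) ->.
move: mD; rewrite /= !inE => /orP[] /andP[mN mI]; apply/orP; [right|left];
  by apply/colex_ltP; exists m; split=> // k /eqAB.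
Qed.

(** The larger of the two witnesses serves for [A] and [C]; they cannot coincide, since [m] lies in
    [B] and [p] does not. *)
Lemma colex_lt_trans : transitive (@colex_lt n).
Proof.
move=> B A C /colex_ltP[m [mA mB eqAB]] /colex_ltP[p [pB pC eqBC]].
apply/colex_ltP; case: (ltngtP m p) => [lt_mp | lt_pm | /val_inj eq_mp].
- exists p; split=> [|//|k lt_pk]; first by rewrite eqAB.
  by rewrite eqAB ?eqBC // (ltn_trans lt_mp).
- exists m; split=> [//||k lt_mk]; first by rewrite -eqBC.
  by rewrite eqAB ?eqBC // (ltn_trans lt_pm).
- by move: pB; rewrite -eq_mp mB.
Qed.

Lemma colex_le_trans : transitive (@colex_le n).
Proof.
move=> B A C /predU1P[-> // | ltAB] /predU1P[<- | ltBC].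
  by rewrite /colex_le ltAB orbT.
by rewrite /colex_le (colex_lt_trans _ _ _ ltAB ltBC) orbT.
Qed.

Lemma colex_le_refl : reflexive (@colex_le n).
Proof. by move=> A; rewrite /colex_le eqxx. Qed.

Lemma colex_lt_irr A : colex_lt A A = false.
Proof. by apply/colex_ltP => -[m [/negP]]. Qed.

Lemma colex_lt_geF A B : colex_lt A B -> colex_le B A = false.
Proof.
move=> ltAB; apply/negP => /predU1P[eqBA | ltBA].
  by rewrite eqBA colex_lt_irr in ltAB.
by have := colex_lt_trans _ _ _ ltAB ltBA; rewrite colex_lt_irr.
Qed.

(** The witness is the maximum of [A]: it is at least [c], so [B] has no element from there on. *)
Lemma colex_lt_initial (c : nat) A B (a : 'I_n) :
  B \subset [set i : 'I_n | i < c] -> a \in A -> c <= a -> colex_lt B A.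
Proof.
move=> /subsetP sB aA le_ca.
case: (@arg_maxnP _ a (fun k => k \in A) val aA) => m mA maxm.
have notB (k : 'I_n) : m <= k -> k \notin B.
  move=> le_mk; apply/negP => /sB; rewrite inE ltnNge.
  by rewrite (leq_trans le_ca) // (leq_trans (maxm _ aA)).
apply/colex_ltP; exists m; split=> [||k lt_mk] //; first exact: notB.
rewrite (negbTE (notB _ (ltnW lt_mk))); apply/esym/negP => /maxm.
by rewrite /= leqNgt lt_mk.
Qed.

(** If [A] had an element [a >= c], all ['C(c, r)] of the [r]-subsets of the initial segment would
    precede [A] in the sorted list, so the index of [A] would be at least [e]. *)
Lemma colex_graph_initial (r c e : nat) A :
    c <= n -> e <= 'C(c, r) -> A \in colex_graph r n e ->
  A \subset [set i : 'I_n | i < c].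
Proof.
move=> le_cn le_e; rewrite inE => Ae.
apply/subsetP => a aA; rewrite inE ltnNge; apply/negP => le_ca.
pose s := colex_list r n.
have As : A \in s by exact: mem_take Ae.
have lt_ie : index A s < e.
  by move: Ae; rewrite in_take.
suff : 'C(c, r) <= index A s by rewrite leqNgt (leq_trans lt_ie le_e).
rewrite -(card_initial_segment _ _ le_cn) -cards_draws.
apply: (@leq_trans (size (take (index A s) s))); last first.
  by rewrite size_take_min geq_minl.
rewrite cardE; apply: uniq_leq_size => [|B]; first exact: enum_uniq.
rewrite mem_enum inE => /andP[sB rB].
have Bs : B \in s by rewrite mem_sort mem_enum inE.
(* Were [B] not listed before [A], sortedness would give [A] below or equal to [B], against
   [colex_lt_initial]. *)
rewrite in_take // ltnNge; apply/negP => le_AB.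
have s_sorted : sorted (@colex_le n) s := sort_sorted colex_le_total _.
have := sorted_leq_index colex_le_trans colex_le_refl s_sorted A B As Bs le_AB.
by rewrite (colex_lt_geF _ _ (colex_lt_initial _ _ _ _ sB aA le_ca)).
Qed.

End ColexOrder.

Theorem theorem3 (r n e : nat) (T : finType) (H : {set {set T}})
  (hr : 1 <= r) (hn : #|T| = n) (hH : is_rgraph r H) (he : #|H| = e) :
  i1 H <= i1 (colex_graph r n e).
Proof.
have le_cn : #|cover H| <= n by rewrite -hn max_card.
have le_e : e <= 'C(#|cover H|, r) by rewrite -he card_rgraph_leq.
(* Comparing exponents and passing to complements reverses the inequality: the colex graph must
   cover at most [#|cover H|] vertices. *)
rewrite !i1E leq_exp2l // (cardsCs (~: cover H)) (cardsCs (~: cover _)) !setCK.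
rewrite hn card_ord leq_sub2l //.
rewrite -[leqRHS](card_initial_segment _ _ le_cn) subset_leq_card //.
by apply/bigcupsP => A; apply: colex_graph_initial le_e.
Qed.
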